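(* Let $f\colon \mathbb{R}^d_{\ge}\to\mathbb{R}_{\ge}$ be a size function for ellipsoids such that $f\circ w^{-1}$ is strictly convex on $\mathbb{R}^d_{>}$. Let $F\subset\mathbb{R}^d$ be a compact convex body. Then among all ellipsoids that contain $F$ there exists a unique ellipsoid that is minimal with respect to $f$; that is, there is exactly one ellipsoid $E\supset F$ such that $f(E)\le f(E')$ for every ellipsoid $E'\supset F$.
   Context: $\mathbb{R}_{>}$ and $\mathbb{R}_{\ge}$ denote the positive and the non-negative reals; $\mathbb{R}^d_{>}$ and $\mathbb{R}^d_{\ge}$ are the sets of vectors in $\mathbb{R}^d$ with all entries in $\mathbb{R}_{>}$, respectively $\mathbb{R}_{\ge}$. A convex body is a compact convex set with non-empty interior. The ellipsoids considered here are the sets of the form $E=\{x\in\mathbb{R}^d : \|P\cdot x+t\|\le 1\}$ with $P\in\mathbb{R}^{d\times d}$ symmetric and positive definite and $t\in\mathbb{R}^d$, where $\|\cdot\|$ is the Euclidean norm. The semi-axis lengths of $E$ are the reciprocals of the eigenvalues of $P$. A function $f\colon\mathbb{R}^d_{\ge}\to\mathbb{R}_{\ge}$ is called a size function for ellipsoids if it is continuous, strictly monotone increasing in each of its arguments, and symmetric (i.e. $f(y)=f(x)$ whenever $y$ is a permutation of $x$). For an ellipsoid $E$, $f(E)$ denotes the value of $f$ at the vector of semi-axis lengths of $E$. For $p\in\mathbb{R}$, $w^p$ is the map $(x_1,\dots,x_d)^T\mapsto(|x_1|^p,\dots,|x_d|^p)^T$; in particular $w^{-1}(x)=(1/x_1,\dots,1/x_d)^T$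 on $\mathbb{R}^d_{>}$. *)

(* Defs.v *)
(* MathComp + MathComp-Analysis *)
From HB Require Import structures.
From mathcomp Require Import all_boot all_order all_algebra all_fingroup.
From mathcomp Require Import all_classical all_reals all_analysis.

Set Implicit Arguments.
Unset Strict Implicit.
Unset Printing Implicit Defensive.

Import Order.TTheory GRing.Theory Num.Theory.
Import numFieldNormedType.Exports.

Local Open Scope classical_set_scope.
Local Open Scope ring_scope.

Section Defs.
Variables (R : realType) (d : nat).
Implicit Types (x y t a : 'cV[R]_d) (P : 'M[R]_d) (E F : set 'cV[R]_d).

(* The library norm `|x| on matrices is the sup norm. *)
Definition eucl_norm x : R := Num.sqrt (\sum_(i < d) x i 0 ^+ 2).

Definition nneg_orthant : set 'cV[R]_d := [set x | forall i, 0 <= x i 0].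

Definition pos_orthant : set 'cV[R]_d := [set x | forall i, 0 < x i 0].

Definition w_pow (p : R) x : 'cV[R]_d := \col_i (`|x i 0| `^ p).

Definition strictly_convex_on (A : set 'cV[R]_d) (g : 'cV[R]_d -> R) : Prop :=
  forall x y (s : R), A x -> A y -> x != y -> 0 < s -> s < 1 ->
    g (s *: x + (1 - s) *: y) < s * g x + (1 - s) * g y.

Definition convex_body F : Prop := [/\ compact F, convex_set F & F° !=set0].

Definition posdef P : Prop :=
  forall x, x != 0 -> 0 < (x^T *m P *m x) 0 0.

Definition ellipsoid P t : set 'cV[R]_d :=
  [set x | eucl_norm (P *m x + t) <= 1].

Definition is_ellipsoid E : Prop :=
  exists P t, [/\ P \is symmetricmx, posdef P & E = ellipsoid P t].

(* The eigenvalues of P, counted with multiplicity, are the roots of its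
   characteristic polynomial; the semi-axis lengths are their reciprocals,
   listed in any order. Since posdef P makes 0 a non-root, the convention
   0^-1 = 0 plays no role. *)
Definition is_semi_axes E a : Prop :=
  exists P t, [/\ P \is symmetricmx, posdef P, E = ellipsoid P t &
    char_poly P = \prod_(i < d) ('X - ((a i 0)^-1)%:P)].

(* One listing of the semi-axis lengths. The pair (P, t) is determined by E and
   a real symmetric P has all its eigenvalues in R, so for an ellipsoid E a
   listing exists and is unique up to permutation; the default 0 is only
   reached when E is not an ellipsoid. *)
Definition semi_axes E : 'cV[R]_d := xget 0 (is_semi_axes E).

(* A function on the closed orthant is represented by a total function, about
   which nothing is assumed outside the orthant. *)
Record size_function (f : 'cV[R]_d -> R) : Prop := SizeFunction {
  size_function_ge0 : forall x, nneg_orthant x -> 0 <= f x;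
  size_function_continuous : {within nneg_orthant, continuous f};
  size_function_increasing : forall x y (i : 'I_d),
    nneg_orthant x -> nneg_orthant y ->
    (forall j, j != i -> x j 0 = y j 0) -> x i 0 < y i 0 -> f x < f y;
  size_function_symmetric : forall x (s : 'S_d),
    nneg_orthant x -> f (row_perm s x) = f x
}.

Definition ellipsoid_size (f : 'cV[R]_d -> R) E : R := f (semi_axes E).

Definition minimal_ellipsoid (f : 'cV[R]_d -> R) F E : Prop :=
  [/\ is_ellipsoid E, F `<=` E &
    forall E', is_ellipsoid E' -> F `<=` E' ->
      ellipsoid_size f E <= ellipsoid_size f E'].

End Defs.

(* Main.v *)
Require Import Defs.
From mathcomp Require Import all_boot all_order all_algebra all_fingroup.
From mathcomp Require Import all_classical all_reals all_analysis.
From mathcomp Require Import ring lra.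

(** An ellipsoid is coded by a positive definite matrix P and a translation t,
    and its size is g of the eigenvalues of P, where g = f \o w_pow (-1) is
    strictly convex, symmetric and strictly decreasing. Containing F is a convex
    condition on (P, t), so the theorem is a statement of strictly convex
    optimization once the size is known to be strictly convex in P.

    That is Davis' theorem, obtained here from Schur's inequality ([schur]). Let
    P be positive definite. If a conjugate U P U^T is not diagonal, then its
    diagonal is a proper average of two permutations of the diagonal obtained by
    one more plane rotation, and the rotation increases g of the diagonal
    ([conj_diag_lt_rotation]). The orthogonal group being compact, g of the
    diagonal attains its maximum, necessarily at the diagonal conjugates. Hence
    the size is the maximum over U of g (conj_diag U P), and conj_diag U P is
    linear in P.

    Uniqueness ([minimal_ellipsoid_unique]): the midpoint of two minimal pairs
    is strictly better if the matrices differ; if only the translations differ, it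
    contains F with room to spare and can be shrunk. For the size to be a
    function of P at all, the ellipsoid must determine P ([ellipsoid_inj]).

    Existence ([minimal_ellipsoid_exists]): as F contains a ball, the containing
    ellipsoids form a bounded family, so a minimizing sequence has a limit, but
    the limit matrix may have a kernel, and f may well be bounded along
    ellipsoids that grow unboundedly. Such a limit is still not optimal
    ([flat_directions_improve]): raising the zero eigenvalues to a lowers g by
    an amount of order a, while repairing the constraint costs only order a ^ 2. *)

Set Implicit Arguments.
Unset Strict Implicit.
Unset Printing Implicit Defensive.

Import Order.TTheory GRing.Theory Num.Theory.
Import numFieldNormedType.Exports.

Local Open Scope classical_set_scope.
Local Open Scope ring_scope.

(** * Orthogonal matrices and plane rotations *)

Section Algebra.
Variables (R : realType) (d : nat).
Implicit Types (x y z t : 'cV[R]_d) (P A U V : 'M[R]_d).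

Definition sqnorm x : R := \sum_i x i 0 ^+ 2.

Definition orthogonal_matrix U : Prop := U *m U^T = 1%:M.

Definition conj_diag U A : 'cV[R]_d := \col_i (U *m A *m U^T) i i.

Lemma symmetricmxP A : A \is symmetricmx <-> A^T = A.
Proof.
rewrite is_hermitianmxE expr0 scale1r map_mx_id //.
by split=> [/eqP <-|->].
Qed.

Lemma sqnormE x : sqnorm x = (x^T *m x) 0 0.
Proof. by rewrite mxE; apply: eq_bigr => i _; rewrite mxE expr2. Qed.

Lemma sqnorm_ge0 x : 0 <= sqnorm x.
Proof. by apply: sumr_ge0 => i _; rewrite sqr_ge0. Qed.

Lemma sqnorm_eq0 x : sqnorm x = 0 -> x = 0.
Proof.
move=> /eqP; rewrite psumr_eq0 => [/allP x0|i _]; last exact: sqr_ge0.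
apply/colP => i; rewrite mxE; apply/eqP.
by have := x0 i; rewrite mem_index_enum sqrf_eq0 => /(_ isT).
Qed.

Lemma sqnormZ (a : R) x : sqnorm (a *: x) = a ^+ 2 * sqnorm x.
Proof. by rewrite mulr_sumr; apply: eq_bigr => i _; rewrite mxE exprMn. Qed.

Lemma ellipsoidE P t x : ellipsoid P t x <-> sqnorm (P *m x + t) <= 1.
Proof.
rewrite /ellipsoid /eucl_norm /=.
by rewrite -[X in _ <= X]sqrtr1 ler_sqrt.
Qed.

Lemma orthogonal1 : orthogonal_matrix 1%:M.
Proof. by rewrite /orthogonal_matrix trmx1 mulmx1. Qed.

Lemma orthogonalM U V : orthogonal_matrix U -> orthogonal_matrix V ->
  orthogonal_matrix (U *m V).
Proof.
move=> oU oV.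
by rewrite /orthogonal_matrix trmx_mul mulmxA -[U *m V *m _]mulmxA oV mulmx1.
Qed.

Lemma orthogonal_trK U : orthogonal_matrix U -> U^T *m U = 1%:M.
Proof. exact: mulmx1C. Qed.

Lemma orthogonal_entry U i j : orthogonal_matrix U -> `|U i j| <= 1.
Proof.
move=> oU; have := congr1 (fun M : 'M[R]_d => M i i) oU.
rewrite !mxE eqxx mulr1n.
rewrite (bigD1 j) //= mxE -expr2 => h.
rewrite -(@ler_sqr _ `|U i j| 1) ?nnegrE // expr1n -h real_normK ?num_real //.
rewrite lerDl; apply: sumr_ge0 => k _; rewrite mxE -expr2; exact: sqr_ge0.
Qed.

Lemma sqnorm_orthogonal U x : orthogonal_matrix U -> sqnorm (U *m x) = sqnorm x.
Proof.
move=> oU; rewrite !sqnormE trmx_mul mulmxA -(mulmxA x^T).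
by rewrite orthogonal_trK // mulmx1.
Qed.

Lemma conj_diagM U V A : conj_diag (U *m V) A = conj_diag U (V *m A *m V^T).
Proof. by apply/colP => i; rewrite [LHS]mxE [RHS]mxE trmx_mul !mulmxA. Qed.

Lemma conj_diag_lin U A V (a b : R) :
  conj_diag U (a *: A + b *: V) = a *: conj_diag U A + b *: conj_diag U V.
Proof.
apply/colP => i.
by rewrite [LHS]mxE mulmxDr mulmxDl -!scalemxAr -!scalemxAl !mxE.
Qed.

Lemma conj_diag_pos U A : posdef A -> orthogonal_matrix U ->
  pos_orthant (conj_diag U A).
Proof.
move=> Apos oU i; rewrite /conj_diag mxE.
have u0 : U^T *m delta_mx i (0 : 'I_1) != 0.
  apply/eqP => /(congr1 (mulmx U)); rewrite mulmxA oU mul1mx mulmx0.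
  by move=> /matrixP /(_ i 0) /eqP; rewrite !mxE !eqxx oner_eq0.
have := Apos _ u0; congr (0 < _).
by rewrite trmx_mul trmxK trmx_delta !mulmxA -rowE -!row_mul -colE !mxE.
Qed.


(** A matrix whose row k is a k *: e_k + b k *: e_(s k) covers a plane rotation
    and the identity outside the plane by one formula; A = 1 gives its
    orthogonality, A arbitrary the diagonal of the conjugate. *)
Lemma two_term_rows (a b : 'I_d -> R) (s : 'I_d -> 'I_d) A k l :
  let J := \matrix_(p, q) (a p * (q == p)%:R + b p * (q == s p)%:R) in
  (J *m A *m J^T) k l =
    a k * a l * A k l + a k * b l * A k (s l)
    + b k * a l * A (s k) l + b k * b l * A (s k) (s l).
Proof.
move=> J.
have JM (B : 'M[R]_d) p q : (J *m B) p q = a p * B p q + b p * B (s p) q.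
  rewrite mxE.
  under eq_bigr do rewrite mxE mulrDl -!mulrA.
  rewrite big_split /= -!mulr_sumr; congr (_ * _ + _ * _).
    rewrite (bigD1 p) //= eqxx mul1r big1 ?addr0 // => r /negPf ->.
    by rewrite mul0r.
  rewrite (bigD1 (s p)) //= eqxx mul1r big1 ?addr0 // => r /negPf ->.
  by rewrite mul0r.
rewrite -mulmxA JM.
have AJ p q : (A *m J^T) p q = a q * A p q + b q * A p (s q).
  by rewrite -[A *m _]trmxK trmx_mul trmxK [LHS]mxE JM !mxE.
by rewrite !AJ; ring.
Qed.

(** The rotation (co, si) diagonalizes the symmetric 2x2 block with diagonal
    (a, b) and off-diagonal entry h, into eigenvalues y and z. Conjugating back
    writes (a, b) as an average of (y, z) and (z, y), with weight co ^+ 2; the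
    average is proper because h != 0 forces si != 0 and y != z. *)
Lemma planar_rotation (a b h : R) : h != 0 ->
  exists co si : R,
    let y := co ^+ 2 * a + 2 * (co * si) * h + si ^+ 2 * b in
    let z := si ^+ 2 * a - 2 * (co * si) * h + co ^+ 2 * b in
    [/\ co ^+ 2 + si ^+ 2 = 1, 0 < co ^+ 2 < 1, y != z,
        a = co ^+ 2 * y + (1 - co ^+ 2) * z &
        b = co ^+ 2 * z + (1 - co ^+ 2) * y].
Proof.
move=> h0.
have h2 : 0 < h ^+ 2 by rewrite exprn_even_gt0.
have [D D0 D2] : exists2 D, 0 < D & D ^+ 2 = (a - b) ^+ 2 + 4 * h ^+ 2.
  exists (Num.sqrt ((a - b) ^+ 2 + 4 * h ^+ 2)).
    by rewrite sqrtr_gt0 ltr_wpDl ?sqr_ge0 // mulr_gt0.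
  by rewrite sqr_sqrtr // addr_ge0 ?sqr_ge0 // mulr_ge0 // ltW.
(* u is the gap between the larger eigenvalue of the 2x2 block and a *)
have [u uD] : exists u, 2 * u = b - a + D.
  by exists ((b - a + D) / 2); field.
have u2 : u * (u + a - b) = h ^+ 2.
  have De : D = 2 * u + a - b by rewrite uD; ring.
  by move: D2; rewrite De; lra.
have u0 : u != 0.
  by apply/eqP => u0; move: u2 h2; rewrite u0 mul0r => <-; rewrite ltxx.
have u20 : 0 < u ^+ 2 by rewrite exprn_even_gt0.
have n0 : 0 < h ^+ 2 + u ^+ 2 by rewrite addr_gt0.
have nn0 := lt0r_neq0 n0.
have [r r0 r2] : exists2 r, r != 0 & r ^+ 2 = h ^+ 2 + u ^+ 2.
  exists (Num.sqrt (h ^+ 2 + u ^+ 2)); first by rewrite gt_eqF // sqrtr_gt0.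
  by rewrite sqr_sqrtr // ltW.
exists (h / r), (u / r) => /=.
have -> : h / r * (u / r) = h * u / r ^+ 2 by field.
rewrite !expr_div_n r2.
set y := _ + _ + _; set z := _ - _ + _.
have -> : y = a + u.
  apply: (mulIf nn0); rewrite /y.
  have -> : (a + u) * (h ^+ 2 + u ^+ 2) =
      h ^+ 2 * a + 2 * h ^+ 2 * u + u ^+ 2 * b - u * (h ^+ 2 - u * (u + a - b)).
    by ring.
  by rewrite u2 subrr mulr0 subr0; field.
have -> : z = b - u.
  apply: (mulIf nn0); rewrite /z.
  have -> : (b - u) * (h ^+ 2 + u ^+ 2) =
      u ^+ 2 * a - 2 * h ^+ 2 * u + h ^+ 2 * b + u * (h ^+ 2 - u * (u + a - b)).
    by ring.
  by rewrite u2 subrr mulr0 addr0; field.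
split.
- by field.
- by rewrite divr_gt0 //= ltr_pdivrMr // mul1r ltrDl.
- by rewrite -subr_eq0 (_ : _ - _ = D) ?lt0r_neq0 //; lra.
- apply: (mulIf nn0).
  have -> : a * (h ^+ 2 + u ^+ 2) =
      h ^+ 2 * (a + u) + u ^+ 2 * (b - u)
      - u * (h ^+ 2 - u * (u + a - b)) by ring.
  by rewrite u2 subrr mulr0 subr0; field.
- apply: (mulIf nn0).
  have -> : b * (h ^+ 2 + u ^+ 2) =
      h ^+ 2 * (b - u) + u ^+ 2 * (a + u)
      + u * (h ^+ 2 - u * (u + a - b)) by ring.
  by rewrite u2 subrr mulr0 addr0; field.
Qed.

(** Jacobi's step: a nonzero off-diagonal entry means that the diagonal of A is
    a proper convex combination of two permutations of the diagonal of some
    conjugate of A. *)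
Lemma rotation_diagonalizes A (i j : 'I_d) : A^T = A -> i != j -> A i j != 0 ->
  exists J c, [/\ orthogonal_matrix J, 0 < c < 1,
    conj_diag J A != row_perm (tperm i j) (conj_diag J A) &
    conj_diag 1%:M A = c *: conj_diag J A
      + (1 - c) *: row_perm (tperm i j) (conj_diag J A)].
Proof.
move=> symA ij h0.
have [co [si /=]] := planar_rotation (A i i) (A j j) h0.
set y := _ + _ + _; set z := _ - _ + _; move=> [cs co01 yz ay bz].
have hji : A j i = A i j by rewrite -{1}symA mxE.
pose ca k := if (k == i) || (k == j) then co else 1.
pose cb k := if k == i then si else if k == j then - si else 0.
pose J := \matrix_(p, q) (ca p * (q == p)%:R + cb p * (q == tperm i j p)%:R).
have ji : (j == i) = false by rewrite eq_sym (negPf ij).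
have oJ : orthogonal_matrix J.
{ apply/matrixP => k l; rewrite -{1}[J]mulmx1 two_term_rows !mxE /ca /cb.
  rewrite (inj_eq perm_inj).
  case: tpermP => [->|->|/eqP ki /eqP kj];
    case: tpermP => [->|->|/eqP li /eqP lj];
    rewrite ?eqxx ?ji ?(negPf ij) /=.
  all: rewrite ?[i == l]eq_sym ?[j == l]eq_sym.
  all: try rewrite ?(negPf ki) ?(negPf kj) /=.
  all: try rewrite ?(negPf li) ?(negPf lj) /=.
  all: rewrite ?mulr0n ?mulr1n; try ring.
  all: by rewrite -[RHS]cs; ring. }
have Ji : conj_diag J A i 0 = y.
  by rewrite mxE two_term_rows /ca /cb tpermL eqxx /= hji /y; ring.
have Jj : conj_diag J A j 0 = z.
  by rewrite mxE two_term_rows /ca /cb tpermR eqxx ji /= hji /z; ring.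
have Jk k : k != i -> k != j -> conj_diag J A k 0 = A k k.
  move=> ki kj; rewrite mxE two_term_rows /ca /cb (negPf ki) (negPf kj) /=.
  by rewrite !mul1r !(mul0r, mulr0) !addr0.
exists J, (co ^+ 2); split => //.
  apply: contra yz => /eqP /matrixP /(_ i 0) e.
  by rewrite -Ji e mxE tpermL Jj.
apply/colP => k.
have -> : conj_diag 1%:M A k 0 = A k k by rewrite mxE trmx1 mul1mx mulmx1.
rewrite [RHS]mxE [X in X + _]mxE [X in _ + X]mxE [row_perm _ _ _ _]mxE.
case: tpermP => [->|->|/eqP ki /eqP kj].
- by rewrite Ji Jj.
- by rewrite Ji Jj.
- by rewrite Jk //; ring.
Qed.

End Algebra.
(** * Continuity and compactness for matrices *)

Section MatrixTopology.
Variable R : realType.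

(** Neighbourhoods of a matrix are generated by products of neighbourhoods of
    its entries. *)
Lemma cvg_mx (T : Type) (F : set_system T) {FF : Filter F} m n
    (h : T -> 'M[R]_(m, n)) (M : 'M[R]_(m, n)) :
  (forall i j, h x i j @[x --> F] --> M i j) -> h x @[x --> F] --> M.
Proof.
move=> hM B [P PM PB]; rewrite nbhs_filterE.
have : \forall x \near F, forall ij : 'I_m * 'I_n, P ij.1 ij.2 (h x ij.1 ij.2).
  apply: filter_forall => ij; have := hM ij.1 ij.2 _ (PM ij.1 ij.2); exact.
by apply: filterS => x hx; apply: PB => i j; exact: (hx (i, j)).
Qed.

Lemma cvg_coord (T : Type) (F : set_system T) {FF : Filter F} m n
    (h : T -> 'M[R]_(m, n)) (M : 'M[R]_(m, n)) i j :
  h x @[x --> F] --> M -> h x i j @[x --> F] --> M i j.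
Proof.
move=> hM.
have cM := @coord_continuous _ _ _ i j M.
exact: (@cvg_comp _ _ _ h (fun N => N i j) _ _ _ hM cM).
Qed.

Lemma cvg_sum (T : Type) (F : set_system T) {FF : Filter F} (I : finType)
    (h : I -> T -> R) (a : I -> R) :
  (forall i, h i x @[x --> F] --> a i) ->
  \sum_i h i x @[x --> F] --> \sum_i a i.
Proof.
move=> ha; apply: cvg_big => [|i _]; [exact: add_continuous|exact: ha].
Qed.

Lemma cvg_mulmx (T : Type) (F : set_system T) {FF : Filter F} m n p
    (h : T -> 'M[R]_(m, n)) (k : T -> 'M[R]_(n, p))
    (M : 'M[R]_(m, n)) (N : 'M[R]_(n, p)) :
  h x @[x --> F] --> M -> k x @[x --> F] --> N ->
  h x *m k x @[x --> F] --> M *m N.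
Proof.
move=> hM kN; apply: cvg_mx => i j; rewrite mxE.
under eq_fun do rewrite mxE.
by apply: cvg_sum => l; apply: cvgM; exact: cvg_coord.
Qed.

Lemma cvg_trmx (T : Type) (F : set_system T) {FF : Filter F} m n
    (h : T -> 'M[R]_(m, n)) (M : 'M[R]_(m, n)) :
  h x @[x --> F] --> M -> (h x)^T @[x --> F] --> M^T.
Proof.
move=> hM; apply: cvg_mx => i j; rewrite mxE.
by under eq_fun do rewrite mxE; exact: cvg_coord.
Qed.

Lemma mx_box_compact m n (B : R) :
  compact [set M : 'M[R]_(m, n) | forall i j, `|M i j| <= B].
Proof.
have -> : [set M : 'M[R]_(m, n) | forall i j, `|M i j| <= B] =
    vec_mx @` [set v : 'rV[R]_(m * n) | forall i, `[- B, B]%classic (v 0 i)].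
  apply/seteqP; split=> [M MB|_ [v vB <-] i j].
    exists (mxvec M); last exact: mxvecK.
    move=> k; case/mxvec_indexP: k => i j.
    by rewrite mxvecE /= in_itv /= -ler_norml.
  by rewrite mxE ler_norml; have := vB (mxvec_index i j); rewrite /= in_itv.
apply: continuous_compact.
  apply: continuous_subspaceT => v.
  apply: (@cvg_mx _ (nbhs v) _) => i j; rewrite mxE.
  by under eq_fun do rewrite mxE; exact: coord_continuous.
apply: (@rV_compact _ _ (fun=> `[- B, B]%classic)) => _.
exact: segment_compact.
Qed.

Lemma orthogonal_compact d : compact [set U : 'M[R]_d | orthogonal_matrix U].
Proof.
apply: (@subclosed_compact _ _ [set U : 'M[R]_d | forall i j, `|U i j| <= 1]).
- have -> : [set U : 'M[R]_d | orthogonal_matrix U] =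
    (fun U : 'M[R]_d => U *m U^T) @^-1` [set 1%:M] by [].
  apply: preimage_closed; last first.
    apply: accessible_closed_set1; apply: hausdorff_accessible.
    exact: norm_hausdorff.
  move=> U _; apply: (@cvg_mulmx _ (nbhs U) _ _ _ _ id); first exact: cvg_id.
  by apply: (@cvg_trmx _ (nbhs U) _ _ _ id); exact: cvg_id.
- exact: mx_box_compact.
- by move=> U oU i j; exact: orthogonal_entry.
Qed.

Lemma cvg_conj_diag (T : Type) (F : set_system T) {FF : Filter F} d
    (h : T -> 'M[R]_d) (U A : 'M[R]_d) :
  h x @[x --> F] --> U -> conj_diag (h x) A @[x --> F] --> conj_diag U A.
Proof.
move=> hU; apply: cvg_mx => i j; rewrite mxE.
under eq_fun do rewrite mxE.
apply: cvg_coord; apply: cvg_mulmx; last exact: cvg_trmx.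
by apply: cvg_mulmx => //; exact: cvg_cst.
Qed.

Lemma pos_orthant_open d : open (@pos_orthant R d).
Proof.
rewrite openE => x x0.
rewrite /interior.
apply: (@filter_forall _ _ (fun i => [set y : 'cV[R]_d | 0 < y i 0]) (nbhs x)).
move=> i; apply: (@cvgr_gt _ _ _ _ (fun y : 'cV[R]_d => y i 0) (x i 0)) => //.
exact: coord_continuous.
Qed.

End MatrixTopology.

(** * Sizes as functions of the eigenvalues *)

(** These are the properties of f \o w_pow (-1) that the geometry uses. Passing
    from semi-axes to their reciprocals, the eigenvalues of the matrix of the
    ellipsoid, reverses monotonicity and puts convexity where the family of
    containing ellipsoids is itself convex, in the pair (P, t). *)
Record eigenvalue_size (R : realType) d (g : 'cV[R]_d -> R) : Prop :=
  EigenvalueSize {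
  es_ge0 : forall y, pos_orthant y -> 0 <= g y;
  es_anti : forall y z : 'cV[R]_d, pos_orthant y ->
    (forall i, y i 0 <= z i 0) -> y != z -> g z < g y;
  es_sym : forall y (s : 'S_d), pos_orthant y -> g (row_perm s y) = g y;
  es_cont : forall y, pos_orthant y -> {for y, continuous g};
  es_conv : strictly_convex_on (@pos_orthant R d) g
}.

Section SizeFunction.
Variables (R : realType) (d : nat) (f : 'cV[R]_d -> R).
Hypothesis hf : size_function f.

Lemma pos_nneg_orthant (y : 'cV[R]_d) : pos_orthant y -> nneg_orthant y.
Proof. by move=> y0 i; exact: ltW. Qed.

Lemma w_inv_pos (y : 'cV[R]_d) : pos_orthant y -> pos_orthant (w_pow (-1) y).
Proof. by move=> y0 i; rewrite mxE powR_gt0 // normr_gt0 gt_eqF. Qed.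

Lemma w_invE (y : 'cV[R]_d) i : pos_orthant y ->
  w_pow (-1) y i 0 = (y i 0)^-1.
Proof. by move=> y0; rewrite mxE gtr0_norm // powR_inv1 // ltW. Qed.

(** A size function increases in one coordinate at a time, so the coordinates in
    which x and y differ are raised one by one. *)
Lemma size_function_lt (x y : 'cV[R]_d) : nneg_orthant x ->
  (forall i, x i 0 <= y i 0) -> x != y -> f x < f y.
Proof.
have [n] := ubnP #|[pred i | x i 0 != y i 0]|.
elim: n x => // n IH x; rewrite ltnS => xn x0 xy neq.
have [i xyi] : exists i, x i 0 != y i 0.
  apply/existsP; rewrite -negb_forall; apply: contra neq => /forallP e.
  by apply/eqP/colP => i; exact/eqP.
pose x' : 'cV[R]_d := \col_j (if j == i then y j 0 else x j 0).
have x'0 : nneg_orthant x'.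
  by move=> j; rewrite mxE; case: eqP => // ->; exact: le_trans (xy i).
have ltx : f x < f x'.
  apply: (size_function_increasing hf (i := i)) => //.
    by move=> j /negPf ji; rewrite mxE ji.
  by rewrite mxE eqxx lt_neqAle xyi xy.
have [<- //|neq'] := eqVneq x' y.
apply: lt_trans ltx (IH x' _ x'0 _ neq'); last first.
  by move=> j; rewrite mxE; case: eqP => // _.
apply: leq_trans xn; apply: proper_card; apply/properP; split.
  apply/fintype.subsetP => j; rewrite !inE mxE.
  by case: (j == i) => //; rewrite eqxx.
by exists i; rewrite !inE // mxE eqxx eqxx.
Qed.

Lemma size_function_continuous_pos x : pos_orthant x -> {for x, continuous f}.
Proof.
move=> x0; have := size_function_continuous hf.
move=> /(continuous_subspaceW (@pos_nneg_orthant)).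
rewrite continuous_open_subspace; last exact: pos_orthant_open.
by apply; rewrite inE.
Qed.

Hypothesis hconv : strictly_convex_on (@pos_orthant R d) (f \o w_pow (-1)).

Lemma size_function_eigenvalue_size : eigenvalue_size (f \o w_pow (-1)).
Proof.
split => //=.
- move=> y y0; apply: (size_function_ge0 hf).
  exact/pos_nneg_orthant/w_inv_pos.
- move=> y z y0 yz neq.
  have z0 : pos_orthant z by move=> i; exact: lt_le_trans (yz i).
  apply: size_function_lt; first exact/pos_nneg_orthant/w_inv_pos.
    by move=> i; rewrite !w_invE // lef_pV2 // posrE.
  apply: contra neq => /eqP /matrixP e; apply/eqP/colP => i.
  by have := e i 0; rewrite !w_invE // => /invr_inj.
- move=> y s y0; rewrite -[RHS](size_function_symmetric hf s).
    by congr f; apply/colP => i; rewrite !mxE.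
  exact/pos_nneg_orthant/w_inv_pos.
- move=> y y0; apply: continuous_comp; last first.
    exact/size_function_continuous_pos/w_inv_pos.
  apply: (@cvg_mx _ _ (nbhs y) _) => i j; rewrite ord1.
  have -> : w_pow (-1) y i 0 = (y i 0)^-1 by rewrite w_invE.
  have : (x i 0)^-1 @[x --> y] --> (y i 0)^-1.
    by apply: cvgV; [rewrite gt_eqF|exact: coord_continuous].
  apply: cvg_trans; apply: near_eq_cvg.
  near=> x; rewrite w_invE //; near: x.
  exact: (pos_orthant_open y0).
Unshelve. all: by end_near. Qed.

End SizeFunction.
(** * Diagonals of conjugates of a positive definite matrix *)

Section Schur.
Variables (R : realType) (d : nat) (g : 'cV[R]_d -> R).
Hypothesis hg : eigenvalue_size g.
Implicit Types (y z : 'cV[R]_d) (P A U V : 'M[R]_d).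

Lemma es_anti_le y z : pos_orthant y -> (forall i, y i 0 <= z i 0) ->
  g z <= g y.
Proof.
move=> y0 yz; have [<- //|neq] := eqVneq y z.
exact/ltW/(es_anti hg).
Qed.

Lemma es_conv_le y z (s : R) : pos_orthant y -> pos_orthant z -> 0 < s < 1 ->
  g (s *: y + (1 - s) *: z) <= s * g y + (1 - s) * g z.
Proof.
move=> y0 z0 /andP[s0 s1]; have [<-|neq] := eqVneq y z.
  by rewrite -scalerDl -mulrDl addrC subrK scale1r mul1r.
by apply/ltW/(es_conv hg).
Qed.

Lemma symmetric_conj U A : A^T = A -> (U *m A *m U^T)^T = U *m A *m U^T.
Proof. by move=> sA; rewrite !trmx_mul trmxK sA mulmxA. Qed.

(** The diagonal is a proper average of two permuted copies of the diagonal
    obtained after a rotation, and a strictly convex symmetric g is strictly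
    smaller at such an average than at the copies. *)
Lemma conj_diag_lt_rotation A V : A^T = A -> posdef A -> orthogonal_matrix V ->
  ~~ is_diag_mx (V *m A *m V^T) ->
  exists2 U, orthogonal_matrix U & g (conj_diag V A) < g (conj_diag U A).
Proof.
move=> sA pA oV ndiag; set B := V *m A *m V^T in ndiag.
have [i [j [ij Bij]]] : exists i j, i != j /\ B i j != 0.
  move: ndiag => /is_diag_mxP /existsNP[i /existsNP[j]].
  move=> /not_implyP[ij /eqP Bij].
  by exists i, j.
have [J [c [oJ /andP[c0 c1] neq eB]]] :=
  rotation_diagonalizes (symmetric_conj V sA) ij Bij.
have oJV := orthogonalM oJ oV.
exists (J *m V) => //.
have -> : conj_diag V A = conj_diag 1%:M B by rewrite -conj_diagM mul1mx.
have eJ : conj_diag J B = conj_diag (J *m V) A by rewrite conj_diagM.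
rewrite -/B eJ in eB neq; rewrite eB.
have y0 : pos_orthant (conj_diag (J *m V) A) := conj_diag_pos pA oJV.
have z0 : pos_orthant (row_perm (tperm i j) (conj_diag (J *m V) A)).
  by move=> k; rewrite mxE.
apply: lt_le_trans (es_conv hg y0 z0 neq c0 c1) _.
by rewrite (es_sym hg) // -mulrDl addrC subrK mul1r.
Qed.

(** The orthogonal group is compact and g is continuous at the positive vectors
    conj_diag U A. *)
Lemma schur_max A : A^T = A -> posdef A ->
  exists2 U, orthogonal_matrix U &
    forall V, orthogonal_matrix V -> g (conj_diag V A) <= g (conj_diag U A).
Proof.
move=> sA pA.
have [|||U] := @compact_EVT_max _ _ (fun U => g (conj_diag U A))
  [set U : 'M[R]_d | orthogonal_matrix U].
- by exists 1%:M; exact: orthogonal1.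
- exact: orthogonal_compact.
- apply: continuous_in_subspaceT => U; rewrite inE => oU.
  have cU : conj_diag V A @[V --> U] --> conj_diag U A.
    by apply: (@cvg_conj_diag _ _ (nbhs U) _ _ id); exact: cvg_id.
  exact: (cvg_comp _ g cU (es_cont hg (conj_diag_pos pA oU))).
- rewrite inE => oU maxU; exists U => // V oV; apply: maxU; exact: mem_set.
Qed.

(** By [conj_diag_lt_rotation], a maximizer of g over the diagonals of the
    conjugates must diagonalize A. So this is at once the spectral theorem for A
    and the strict form of Schur's inequality: g of any diagonal is at most g of
    the eigenvalues, with equality for diagonal conjugates only. *)
Lemma schur A : A^T = A -> posdef A ->
  exists U, [/\ orthogonal_matrix U, is_diag_mx (U *m A *m U^T),
    forall V, orthogonal_matrix V -> g (conj_diag V A) <= g (conj_diag U A) &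
    forall V, orthogonal_matrix V -> ~~ is_diag_mx (V *m A *m V^T) ->
      g (conj_diag V A) < g (conj_diag U A)].
Proof.
move=> sA pA; have [U oU maxU] := schur_max sA pA.
have strict V : orthogonal_matrix V -> ~~ is_diag_mx (V *m A *m V^T) ->
    g (conj_diag V A) < g (conj_diag U A).
  move=> oV /(conj_diag_lt_rotation sA pA oV) [W oW /lt_le_trans]; apply.
  exact: maxU.
exists U; split => //; apply/negPn/negP => /(strict U oU).
by rewrite ltxx.
Qed.

End Schur.

(** * An ellipsoid determines its matrix, its centre and its size *)

Section Ellipsoids.
Variables (R : realType) (d : nat).
Implicit Types (x y z t s w : 'cV[R]_d) (P Q A U V : 'M[R]_d).

Lemma posdef_inj P x : posdef P -> P *m x = 0 -> x = 0.
Proof.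
move=> pP Px; apply/eqP; apply: contraPT (ltxx (0 : R)) => /pP.
by rewrite -mulmxA Px mulmx0 mxE => ->.
Qed.

Lemma posdef_unit P : posdef P -> P^T = P -> P \in unitmx.
Proof.
move=> pP sP; rewrite -row_free_unit -kermx_eq0; apply/eqP/row_matrixP => i.
rewrite row0; apply: trmx_inj; rewrite trmx0; apply: (posdef_inj pP).
apply: trmx_inj; rewrite trmx_mul trmxK sP trmx0.
by apply/sub_kermxP; exact: row_sub.
Qed.

Lemma sqnormN x : sqnorm (- x) = sqnorm x.
Proof. by apply: eq_bigr => i _; rewrite mxE sqrrN. Qed.

(** Both sides are homogeneous of degree two, so it is enough to compare the
    unit balls; posdef P allows w to be normalized. *)
Lemma sqnorm_mul_le P Q : posdef P ->
  (forall w, sqnorm (P *m w) <= 1 -> sqnorm (Q *m w) <= 1) ->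
  forall w, sqnorm (Q *m w) <= sqnorm (P *m w).
Proof.
move=> pP PQ w; have [->|w0] := eqVneq w 0; first by rewrite !mulmx0.
have N0 : 0 < sqnorm (P *m w).
  rewrite lt_def sqnorm_ge0 andbT; apply: contra w0 => /eqP /sqnorm_eq0.
  by move=> /(posdef_inj pP) ->.
have := PQ ((Num.sqrt (sqnorm (P *m w)))^-1 *: w).
rewrite -!scalemxAr !sqnormZ exprVn sqr_sqrtr ?sqnorm_ge0 //.
rewrite mulVf ?gt_eqF // => /(_ (lexx _)).
by rewrite mulrC ler_pdivrMr // mul1r.
Qed.

Lemma symmetric_form_eq0 A : A^T = A -> (forall x, (x^T *m A *m x) 0 0 = 0) ->
  A = 0.
Proof.
move=> sA A0.
have e p q :
    ((delta_mx p (0 : 'I_1))^T *m A *m (delta_mx q (0 : 'I_1))) 0 0 = A p q.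
  by rewrite trmx_delta -rowE -colE !mxE.
have D p : A p p = 0 by rewrite -e A0.
apply/matrixP => i j; rewrite mxE.
have tD (M N : 'cV[R]_d) : (M + N)^T = M^T + N^T by rewrite linearD.
have := A0 (delta_mx i 0 + delta_mx j 0); rewrite tD mulmxDr !mulmxDl.
have aM (M N : 'M[R]_1) : (M + N) 0 0 = M 0 0 + N 0 0 by rewrite mxE.
have Aji : A j i = A i j by rewrite -{1}sA mxE.
rewrite !aM !e !D add0r addr0 Aji => h.
by lra.
Qed.

Lemma posdefD P Q : posdef P -> posdef Q -> posdef (P + Q).
Proof.
by move=> pP pQ x x0; rewrite mulmxDr mulmxDl mxE addr_gt0 // ?pP ?pQ.
Qed.

(** Uniqueness of the positive square root of P *m P. With A = P - Q and
    S = P + Q, equality of the squares reads A *m S + S *m A = 0, whence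
    \tr (A *m S *m A) = 0; this trace is the sum of the values of the positive
    definite form S at the rows of A. *)
Lemma posdef_sqrt_unique P Q : P^T = P -> Q^T = Q -> posdef P -> posdef Q ->
  (forall w, sqnorm (P *m w) = sqnorm (Q *m w)) -> P = Q.
Proof.
move=> sP sQ pP pQ PQ; pose A := P - Q; pose S := P + Q.
have sA : A^T = A by rewrite linearB /= sP sQ.
have sS : S^T = S by rewrite linearD /= sP sQ.
have AS : A *m S + S *m A = 0.
  apply: symmetric_form_eq0.
    by rewrite linearD /= !trmx_mul sA sS addrC.
  move=> x; have -> : A *m S + S *m A = (P *m P - Q *m Q) *+ 2.
    have gen (a b c e : 'M[R]_d) :
        a + b - (c + e) + (a + c + (- b - e)) = (a - e) *+ 2.
      by apply/matrixP => i j; rewrite mulr2n !mxE; ring.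
    by rewrite /A /S mulmxBl !mulmxDr !mulmxDl !mulmxN gen.
  have xx M : M^T = M -> (x^T *m (M *m M) *m x) 0 0 = sqnorm (M *m x).
    by move=> sM; rewrite sqnormE trmx_mul sM !mulmxA.
  have mn (M N : 'M[R]_1) : (M - N + (M - N)) 0 0 = (M 0 0 - N 0 0) *+ 2.
    by rewrite !mxE mulr2n.
  by rewrite mulr2n mulmxDr mulmxDl mulmxBr mulmxBl mn !xx // PQ subrr mul0rn.
have tr0 : \tr (A *m S *m A^T) = 0.
  have : \tr (A *m S *m A) + \tr (S *m A *m A) = 0.
    by rewrite -linearD /= -mulmxDl AS mul0mx linear0.
  by rewrite [\tr (S *m _ *m _)]mxtrace_mulC mulmxA sA; lra.
apply/eqP; rewrite -subr_eq0 -/A; apply/eqP/row_matrixP => i; rewrite row0.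
have pS : posdef S by exact: posdefD.
have AiE k : (A *m S *m A^T) k k = ((row k A)^T^T *m S *m (row k A)^T) 0 0.
  by rewrite trmxK -row_mul tr_row colE mulmxA -row_mul -colE [RHS]mxE [RHS]mxE.
have Ai_ge0 k : 0 <= (A *m S *m A^T) k k.
  rewrite AiE; have [->|/pS/ltW//] := eqVneq (row k A)^T 0.
  by rewrite mulmx0 mxE.
move/eqP: tr0; rewrite psumr_eq0 // => /allP /(_ i); rewrite mem_index_enum AiE.
move=> /(_ isT) /= /eqP Si; apply: trmx_inj; rewrite trmx0.
apply/eqP; apply: contraPT (ltxx (0 : R)) => /pS.
by rewrite Si => ->.
Qed.

Lemma ellipsoid_centered P t : P^T = P -> posdef P -> exists2 c,
  t = - (P *m c) & forall w, ellipsoid P t (c + w) <-> sqnorm (P *m w) <= 1.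
Proof.
move=> sP pP; have uP := posdef_unit pP sP.
have tE : t = - (P *m - (invmx P *m t)) by rewrite mulmxN mulKVmx // opprK.
exists (- (invmx P *m t)) => // w; rewrite ellipsoidE {2}tE.
by rewrite mulmxDr addrAC subrr add0r.
Qed.

(** Were b and c two centres of one ellipsoid, the composite of the two
    point reflections would be a translation preserving a bounded set, so b = c.
    With a common centre the two ellipsoids have the same norm, and
    [posdef_sqrt_unique] applies. *)
Lemma ellipsoid_inj P Q t s : P^T = P -> Q^T = Q -> posdef P -> posdef Q ->
  ellipsoid P t = ellipsoid Q s -> P = Q /\ t = s.
Proof.
move=> sP sQ pP pQ E.
have [c tc cP] := ellipsoid_centered t sP pP.
have [b sb bQ] := ellipsoid_centered s sQ pQ.
have bc : b = c.
  apply/eqP; rewrite -subr_eq0; apply/eqP.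
  set v := b - c.
  have trans w : sqnorm (P *m w) <= 1 -> sqnorm (P *m (w + v *+ 2)) <= 1.
    (* reflect through c, then through b *)
    rewrite -sqnormN -mulmxN => /cP; rewrite E.
    have -> : c - w = b + (- w - v) by apply/colP => i; rewrite !mxE; ring.
    move=> /bQ; rewrite -sqnormN -mulmxN => /bQ; rewrite -E.
    have -> : b - (- w - v) = c + (w + v *+ 2).
      by apply/colP => i; rewrite mulr2n !mxE; ring.
    by move=> /cP.
  apply: (posdef_inj pP); apply: sqnorm_eq0; apply/eqP.
  case: (eqVneq (sqnorm (P *m v)) 0) => // N0.
  have {}N0 : 0 < sqnorm (P *m v) by rewrite lt_def N0 sqnorm_ge0.
  have r0 : 0 < Num.sqrt (sqnorm (P *m v)) by rewrite sqrtr_gt0.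
  have r2 := sqr_sqrtr (ltW N0).
  move: r0 r2; set r := Num.sqrt _ => r0 r2.
  have := trans (r^-1 *: v).
  rewrite -scaler_nat -scalerDl -!scalemxAr !sqnormZ -r2 -!exprMn.
  rewrite mulVf ?gt_eqF //.
  rewrite expr1n => /(_ (lexx _)).
  rewrite mulrDl mulVf ?gt_eqF // leNgt; case/negP.
  by rewrite exprn_egt1 // ltrDl mulr_gt0.
have PQ w : sqnorm (P *m w) <= 1 <-> sqnorm (Q *m w) <= 1.
  by rewrite -cP -bQ E bc.
have ePQ : P = Q.
  apply: posdef_sqrt_unique => // w; apply/eqP; rewrite eq_le.
  by rewrite !sqnorm_mul_le // => v /PQ.
by split => //; rewrite tc sb bc ePQ.
Qed.

Lemma char_poly_conj U A : orthogonal_matrix U ->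
  char_poly (U *m A *m U^T) = char_poly A.
Proof.
move=> oU; rewrite /char_poly.
have -> : char_poly_mx (U *m A *m U^T) =
    map_mx polyC U *m char_poly_mx A *m map_mx polyC U^T.
  rewrite /char_poly_mx mulmxBr mulmxBl -!map_mxM; congr (_ - _).
  by rewrite scalar_mxC -mulmxA -map_mxM oU map_mx1 mulmx1.
rewrite !det_mulmx mulrAC -det_mulmx -map_mxM oU map_mx1 det1 mul1r //.
Qed.

Lemma char_poly_diagonalized U A : orthogonal_matrix U ->
  is_diag_mx (U *m A *m U^T) ->
  char_poly A = \prod_(i < d) ('X - (conj_diag U A i 0)%:P).
Proof.
move=> oU dA.
rewrite -(char_poly_conj A oU) char_poly_trig ?is_diag_mx_is_trig //.
by apply: eq_bigr => i _; rewrite [conj_diag _ _ _ _]mxE.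
Qed.

(** The size refers to some listing of the semi-axes, found through some
    representation of the ellipsoid. By [ellipsoid_inj] that representation is
    (P, t), so the listing is determined up to a permutation by the roots of the
    characteristic polynomial, and f is symmetric. *)
Lemma ellipsoid_size_diagonalized (f : 'cV[R]_d -> R) P t U :
  size_function f -> P^T = P -> posdef P -> orthogonal_matrix U ->
  is_diag_mx (U *m P *m U^T) ->
  ellipsoid_size f (ellipsoid P t) = (f \o w_pow (-1)) (conj_diag U P).
Proof.
move=> hf sP pP oU dP; set y := conj_diag U P.
have y0 : pos_orthant y := conj_diag_pos pP oU.
have axes : is_semi_axes (ellipsoid P t) (w_pow (-1) y).
  exists P, t; split => //; first exact/symmetricmxP.
  rewrite (char_poly_diagonalized oU dP); apply: eq_bigr => i _.
  by rewrite w_invE // invrK.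
have [Q [s [/symmetricmxP sQ pQ E]]] := xgetI 0 axes.
have [<- _] := ellipsoid_inj sP sQ pP pQ E.
rewrite /ellipsoid_size /semi_axes; set a := xget _ _.
rewrite (char_poly_diagonalized oU dP) -/y.
have tE (b : 'I_d -> R) : \prod_(i < d) ('X - (b i)%:P) =
    \prod_(c <- [tuple b i | i < d]) ('X - c%:P).
  by rewrite big_map val_ord_tuple big_enum.
rewrite (tE (fun i => y i 0)) (tE (fun i => (a i 0)^-1)).
move=> /prod_XsubC_eq; rewrite perm_sym => /tuple_permP[s' e].
have {}e i : (a i 0)^-1 = y (s' i) 0.
  by have := congr1 (fun u => tnth u i) (val_inj e); rewrite !tnth_mktuple.
rewrite -[RHS](size_function_symmetric hf s'); last first.
  exact/pos_nneg_orthant/w_inv_pos.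
by congr f; apply/colP => i; rewrite [RHS]mxE w_invE // -e invrK.
Qed.

End Ellipsoids.
(** * Uniqueness of the minimal ellipsoid *)

Section Uniqueness.
Variables (R : realType) (d : nat) (f : 'cV[R]_d -> R) (F : set 'cV[R]_d).
Hypothesis hf : size_function f.
Hypothesis hconv : strictly_convex_on (@pos_orthant R d) (f \o w_pow (-1)).
Implicit Types (x y z t s w : 'cV[R]_d) (P Q A U V : 'M[R]_d).

Local Notation g := (f \o w_pow (-1)).
Let hg : eigenvalue_size g := size_function_eigenvalue_size hf hconv.

Lemma ellipsoid_size_schur P t : P^T = P -> posdef P ->
  exists U, [/\ orthogonal_matrix U, is_diag_mx (U *m P *m U^T),
    ellipsoid_size f (ellipsoid P t) = g (conj_diag U P),
    forall V, orthogonal_matrix V ->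
      g (conj_diag V P) <= ellipsoid_size f (ellipsoid P t) &
    forall V, orthogonal_matrix V -> ~~ is_diag_mx (V *m P *m V^T) ->
      g (conj_diag V P) < ellipsoid_size f (ellipsoid P t)].
Proof.
move=> sP pP; have [U [oU dU maxU strU]] := schur hg sP pP.
by exists U; rewrite (ellipsoid_size_diagonalized t hf sP pP oU dU).
Qed.

Lemma posdefZ (k : R) P : 0 < k -> posdef P -> posdef (k *: P).
Proof.
by move=> k0 pP x x0; rewrite -scalemxAr -scalemxAl mxE mulr_gt0 ?pP.
Qed.

(** The parallelogram law. *)
Lemma sqnorm_midpoint x y :
  sqnorm (2^-1 *: (x + y)) = (sqnorm x + sqnorm y) / 2 - sqnorm (x - y) / 4.
Proof.
rewrite /sqnorm -big_split /= !mulr_suml -sumrB; apply: eq_bigr => i _.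
by rewrite !mxE; field.
Qed.

Lemma conj_diag_midpoint U P Q :
  conj_diag U (2^-1 *: (P + Q)) =
  2^-1 *: conj_diag U P + (1 - 2^-1) *: conj_diag U Q.
Proof.
rewrite scalerDr conj_diag_lin; congr (_ + _ *: _).
by field.
Qed.

Lemma diag_conj_ext U P Q : orthogonal_matrix U ->
  is_diag_mx (U *m P *m U^T) -> is_diag_mx (U *m Q *m U^T) ->
  conj_diag U P = conj_diag U Q -> P = Q.
Proof.
move=> oU /is_diag_mxP dP /is_diag_mxP dQ PQ.
have UPQ : U *m P *m U^T = U *m Q *m U^T.
  apply/matrixP => i j; have [<-|ij] := eqVneq i j; last by rewrite dP ?dQ.
  by have /matrixP /(_ i 0) := PQ; rewrite mxE [RHS]mxE.
have tU := orthogonal_trK oU.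
have unconj A : A = U^T *m (U *m A *m U^T) *m U.
  by rewrite !mulmxA tU mul1mx -mulmxA tU mulmx1.
by rewrite (unconj P) UPQ -unconj.
Qed.

(** The ellipsoid with matrix (P0 + P1) / 2 and translation (t0 + t1) / 2 still
    contains F. Let U diagonalize its matrix: the eigenvalues are the average of
    the diagonals of the conjugates of P0 and P1, so convexity of g and [schur]
    bound its size by m, strictly unless U diagonalizes both matrices to the
    same diagonal, that is unless P0 = P1. If then t0 != t1, the parallelogram law
    leaves room to enlarge the matrix, which shrinks the ellipsoid. *)
Lemma minimal_ellipsoid_unique E0 E1 :
  minimal_ellipsoid f F E0 -> minimal_ellipsoid f F E1 -> E0 = E1.
Proof.
move=> [[P0 [t0 [/symmetricmxP sP0 pP0 ->]]] FE0 min0].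
move=> [[P1 [t1 [/symmetricmxP sP1 pP1 ->]]] FE1 min1].
have [iE0 iE1] :
    is_ellipsoid (ellipsoid P0 t0) /\ is_ellipsoid (ellipsoid P1 t1).
  by split; [exists P0, t0|exists P1, t1]; split => //; exact/symmetricmxP.
set m := ellipsoid_size f (ellipsoid P0 t0) in min0.
have m1 : ellipsoid_size f (ellipsoid P1 t1) = m.
  by apply/eqP; rewrite eq_le min0 // min1.
pose P := 2^-1 *: (P0 + P1); pose t := 2^-1 *: (t0 + t1).
have sP : P^T = P by rewrite linearZ linearD /= sP0 sP1.
have pP : posdef P by apply: posdefZ; [rewrite invr_gt0|exact: posdefD].
have half_lin x : P *m x + t = 2^-1 *: ((P0 *m x + t0) + (P1 *m x + t1)).
  by rewrite /P /t -scalemxAl mulmxDl -scalerDr addrACA.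
have Fmid x : F x -> sqnorm (P *m x + t) <=
    1 - sqnorm ((P0 *m x + t0) - (P1 *m x + t1)) / 4.
  move=> Fx; rewrite half_lin sqnorm_midpoint lerB // ler_pdivrMr // mul1r.
  have /ellipsoidE h0 := FE0 x Fx; have /ellipsoidE h1 := FE1 x Fx.
  by rewrite -(mulr1n 1) mulr2n lerD.
have [U [oU dU sizeU _ _]] := ellipsoid_size_schur t sP pP.
have mP : m <= g (conj_diag U P).
  rewrite -sizeU; apply: min0.
    by exists P, t; split => //; exact/symmetricmxP.
  move=> x Fx; apply/ellipsoidE; apply: le_trans (Fmid x Fx) _.
  by rewrite gerBl divr_ge0 ?sqnorm_ge0.
have [_ [_ _ _ le0 lt0]] := ellipsoid_size_schur t0 sP0 pP0.
have [_ [_ _ _ le1 lt1]] := ellipsoid_size_schur t1 sP1 pP1.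
rewrite m1 in le1 lt1.
have P01 : P0 = P1.
  move: (conj_diag_pos pP0 oU) (conj_diag_pos pP1 oU) => y0 y1.
  rewrite conj_diag_midpoint in mP.
  have half : 0 < (2^-1 : R) < 1 by lra.
  have /andP[half0 half1] := half.
  have := le0 U oU; have := le1 U oU; rewrite -/m.
  have [y01 b_le a_le|neq b_le a_le] :=
    eqVneq (conj_diag U P0) (conj_diag U P1).
    have mid := le_trans mP (es_conv_le hg y0 y1 half).
    by apply: (diag_conj_ext oU _ _ y01); apply: contraT => nd;
      [have := lt0 U oU nd|have := lt1 U oU nd]; rewrite -/m; lra.
  have mid := le_lt_trans mP (es_conv hg y0 y1 neq half0 half1).
  by suff : m < m by [rewrite ltxx|]; lra.
have [-> //|t01] := eqVneq t0 t1; first by rewrite P01.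
set e := sqnorm (t0 - t1) / 4.
have e0 : 0 < e.
  rewrite divr_gt0 // lt_def sqnorm_ge0 andbT; apply: contra t01 => /eqP.
  by move=> /sqnorm_eq0 /eqP; rewrite subr_eq0.
have [i _] : exists i, t0 i 0 != t1 i 0.
  apply/existsP; rewrite -negb_forall; apply: contra t01 => /forallP h.
  by apply/eqP/colP => i; exact/eqP.
(* On F the quadratic form is at most 1 - e, and (1 + e) * (1 - e) <= 1. *)
pose k := Num.sqrt (1 + e).
have k2 : k ^+ 2 = 1 + e by rewrite sqr_sqrtr // addr_ge0 // ltW.
have k1 : 1 < k by rewrite -sqrtr1 ltr_sqrt ?ltrDl // addr_gt0.
have k0 : 0 < k := lt_trans ltr01 k1.
have dkU : is_diag_mx (U *m (k *: P) *m U^T).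
  rewrite -scalemxAr -scalemxAl; apply/is_diag_mxP => p q pq.
  by rewrite mxE; move/is_diag_mxP : dU => ->; rewrite ?mulr0.
have skP : (k *: P)^T = k *: P by rewrite linearZ /= sP.
have pkP := posdefZ k0 pP.
have : m <= ellipsoid_size f (ellipsoid (k *: P) (k *: t)).
  apply: min0.
    by exists (k *: P), (k *: t); split => //; exact/symmetricmxP.
  move=> x Fx; apply/ellipsoidE; rewrite -scalemxAl -scalerDr sqnormZ k2.
  have := Fmid x Fx; rewrite P01 opprD addrACA subrr add0r -/e => h.
  apply: le_trans (ler_wpM2l _ h) _; first by rewrite addr_ge0 // ltW.
  by rewrite mulrBr mulr1 mulrDl mul1r opprD addrA addrK gerBl mulr_ge0 // ltW.
rewrite (ellipsoid_size_diagonalized _ hf skP pkP oU dkU) leNgt; case/negP.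
have y0 := conj_diag_pos pP oU.
have kE j : conj_diag U (k *: P) j 0 = k * conj_diag U P j 0.
  by rewrite -[k *: P]addr0 -[0](scale0r P) conj_diag_lin !scale0r addr0 mxE.
have PP0 : P = P0 by rewrite /P -P01; apply/matrixP => p q; rewrite !mxE; field.
apply: (@lt_le_trans _ _ (g (conj_diag U P))); last by rewrite PP0; exact: le0.
apply: (es_anti hg) => // [j|].
  by rewrite kE ler_peMl // ltW.
apply/eqP => /matrixP /(_ i 0) /eqP; rewrite kE.
rewrite -subr_eq0 -{1}[conj_diag _ _ _ _]mul1r -mulrBl mulf_eq0 subr_eq0.
by rewrite (lt_eqF k1) gt_eqF.
Qed.

End Uniqueness.
(** * Containing ellipsoids in diagonal coordinates *)

Section Feasible.
Variables (R : realType) (d : nat) (F : set 'cV[R]_d).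
Implicit Types (x y z t s w : 'cV[R]_d) (P Q A U V : 'M[R]_d).

(** The pair (U, y) stands for the matrix U^T *m diag_mx y^T *m U, and t for the
    translation seen in the coordinates of U. Zero and negative y are admitted,
    which makes the condition closed in (U, y, t). *)
Definition feasible U y t : Prop :=
  orthogonal_matrix U /\
  forall x, F x -> sqnorm (diag_mx y^T *m (U *m x) + t) <= 1.

Lemma diag_affineE y z t i :
  (diag_mx y^T *m z + t) i 0 = y i 0 * z i 0 + t i 0.
Proof. by rewrite mul_diag_mx !mxE. Qed.

Lemma feasible_entry U y t x i : feasible U y t -> F x ->
  `|y i 0 * (U *m x) i 0 + t i 0| <= 1.
Proof.
move=> [oU FU] Fx; rewrite -[leRHS]sqrtr1 -sqrtr_sqr ler_sqrt //.
apply: le_trans (FU x Fx); rewrite /sqnorm (bigD1 i) //= diag_affineE.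
by rewrite lerDl; apply: sumr_ge0 => j _; exact: sqr_ge0.
Qed.

(** F contains a ball of radius r. Moving by r / 2 in both senses along the i-th
    row of U changes the i-th coordinate y i * (U x) i + t i by at most 2 in
    total, which bounds y i, and then t i. *)
Lemma feasible_bounded : F° !=set0 -> exists B : R, forall U y t,
  feasible U y t -> forall i, `|y i 0| <= B /\ `|t i 0| <= B.
Proof.
move=> [c /nbhs_ballP[r /= r0 rF]].
pose C : R := \sum_j `|c j 0|.
have C0 : 0 <= C by apply: sumr_ge0.
exists (2 / r + (1 + 2 / r * C)) => U y t UF i.
have oU : orthogonal_matrix U by case: UF.
have inF (a : R) : `|a| < r -> F (c + a *: col i U^T).
  move=> ar; apply: rF; split => // p q; rewrite (ord1 q) /ball /= !mxE.
  rewrite opprD addrA subrr sub0r normrN normrM.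
  apply: le_lt_trans ar; rewrite ler_piMr //.
  exact: orthogonal_entry.
have Ux (a : R) : (U *m (c + a *: col i U^T)) i 0 =
    (U *m c) i 0 + a.
  rewrite mulmxDr -scalemxAr colE mulmxA oU mul1mx mxE; congr (_ + _).
  by rewrite !mxE !eqxx mulr1.
have r2 : `|r / 2| < r.
  by rewrite gtr0_norm ?divr_gt0 // ltr_pdivrMr // mulr_natr mulr2n ltrDl.
have r2N : `|- (r / 2)| < r by rewrite normrN.
move: (feasible_entry i UF (inF _ r2N)) (feasible_entry i UF (inF _ r2)).
rewrite !Ux => /ler_normlP[h1 h2] /ler_normlP[h3 h4].
have Uc : `|(U *m c) i 0| <= C.
  rewrite mxE; apply: le_trans (ler_norm_sum _ _ _) _; apply: ler_sum => j _.
  by rewrite normrM ler_piMl // orthogonal_entry.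
have yr : `|y i 0| <= 2 / r.
  rewrite ler_pdivlMr //; case: (ger0P (y i 0)) => _; nra.
have tb : `|t i 0 + y i 0 * (U *m c) i 0| <= 1.
  by rewrite ler_norml; apply/andP; split; lra.
have yU : `|y i 0 * (U *m c) i 0| <= 2 / r * C by rewrite normrM ler_pM.
have r20 : 0 <= 2 / r by rewrite divr_ge0 // ltW.
have rC0 : 0 <= 2 / r * C by rewrite mulr_ge0.
split; first by apply: le_trans yr _; rewrite lerDl addr_ge0.
have -> : t i 0 = (t i 0 + y i 0 * (U *m c) i 0) - y i 0 * (U *m c) i 0.
  by rewrite addrK.
apply: le_trans (ler_normB _ _) _.
by apply: le_trans (lerD tb yU) _; rewrite lerDr.
Qed.

Lemma closure_le (T : topologicalType) (A : set T) (h : T -> R) p (a : R) :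
  closure A p -> h q @[q --> p] --> h p -> (forall q, A q -> h q <= a) ->
  h p <= a.
Proof.
move=> Ap hp hA; rewrite leNgt; apply/negP => lt.
have [q [Aq]] := Ap _ (cvgr_gt _ hp _ lt).
by rewrite /= ltNge hA.
Qed.

End Feasible.

Section MinimizingSequences.
Variables (R : realType) (d : nat) (F : set 'cV[R]_d) (g : 'cV[R]_d -> R).
Hypothesis hg : eigenvalue_size g.
Hypothesis Fint : F° !=set0.
Implicit Types (x y z t s w : 'cV[R]_d) (P Q A U V : 'M[R]_d).

Lemma nneg_add_const_pos y (e : R) : nneg_orthant y -> 0 < e ->
  pos_orthant (y + const_mx e).
Proof. by move=> y0 e0 i; rewrite !mxE ltr_wpDl. Qed.

(** The eigenvalues of a minimizing sequence may tend to 0, where g need not be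
    continuous. Shifting them by e keeps g continuous; the sets C e
    below are closed, nonempty, nested and lie in a compact set, hence have a
    common point. *)
Lemma feasible_limit (m : R) :
  (forall e, 0 < e ->
    exists U y t, [/\ feasible F U y t, pos_orthant y & g y <= m + e]) ->
  exists U y t, [/\ feasible F U y t, nneg_orthant y &
    forall e, 0 < e -> g (y + const_mx e) <= m + e].
Proof.
move=> minseq; have [B FB] := feasible_bounded Fint.
pose T := ('M[R]_d * ('cV[R]_d * 'cV[R]_d))%type.
pose C (e : R) : set T := [set p | [/\ feasible F p.1 p.2.1 p.2.2,
  nneg_orthant p.2.1 & g (p.2.1 + const_mx e) <= m + e]].
have C0 e : 0 < e -> C e !=set0.
  move=> e0; have [U [y [t [Uyt y0 gy]]]] := minseq e e0.
  exists (U, (y, t)); split => //=; first exact: pos_nneg_orthant.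
  apply: le_trans gy; apply: (es_anti_le hg) => // i.
  by rewrite !mxE lerDl ltW.
have Cmono e e' : 0 < e -> e <= e' -> C e `<=` C e'.
  move=> e0 ee p [Fp y0 gp]; split => //.
  apply: le_trans (_ : m + e <= _); last by rewrite lerD2l.
  apply: le_trans gp; apply: (es_anti_le hg); first exact: nneg_add_const_pos.
  by move=> i; rewrite !mxE lerD2l.
pose K : set T := [set U : 'M[R]_d | forall i j, `|U i j| <= 1] `*`
  ([set y : 'cV[R]_d | forall i j, `|y i j| <= B] `*`
   [set t : 'cV[R]_d | forall i j, `|t i j| <= B]).
have cK : compact K.
  by apply: compact_setX; [|apply: compact_setX]; exact: mx_box_compact.
have CK e : C e `<=` K.
  move=> [U [y t]] [/= Uyt _ _]; split => /= [i j|].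
    by case: Uyt => oU _; exact: orthogonal_entry.
  by split => i j; rewrite (ord1 j); case: (FB _ _ _ Uyt i).
pose G : set_system T := filter_from [set e : R | 0 < e] C.
have GF : ProperFilter G.
  apply: filter_from_proper => //; apply: filter_from_filter.
    by exists 1 => /=.
  move=> e e' /= e0 e0'; exists (Num.min e e'); first by rewrite lt_min e0.
  have mn0 : 0 < Num.min e e' by rewrite lt_min e0.
  by move=> p Cp; split; apply: Cmono Cp => //; rewrite ge_min lexx ?orbT.
have [|p [_ clp]] := cK G GF.
  by exists 1 => //=; exact: CK.
have clC e : 0 < e -> closure (C e) p.
  by move=> e0 N pN; apply: clp => //; exists e.
have c1 : closure (C 1) p by exact: clC.
pose nbp := nbhs p.
have cU : q.1 @[q --> p] --> p.1 by exact: cvg_fst.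
have cy : q.2.1 @[q --> p] --> p.2.1.
  apply: (cvg_comp _ (fun q => q.1) (@cvg_snd _ _ _ _ _)).
  exact: (@cvg_fst _ _ _ _ _).
have ct : q.2.2 @[q --> p] --> p.2.2.
  apply: (cvg_comp _ (fun q => q.2) (@cvg_snd _ _ _ _ _)).
  exact: (@cvg_snd _ _ _ _ _).
have oU : orthogonal_matrix p.1.
  have cUU : q.1 *m q.1^T @[q --> p] --> p.1 *m p.1^T.
    by apply: (@cvg_mulmx _ _ nbp) => //; apply: (@cvg_trmx _ _ nbp).
  apply/matrixP => i j; apply/eqP; rewrite eq_le; apply/andP; split.
    apply: (closure_le (h := fun q : T => (q.1 *m q.1^T) i j) c1).
      exact: (@cvg_coord _ _ nbp).
    by move=> q [[oq _] _ _]; rewrite oq.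
  rewrite -lerN2.
  apply: (closure_le (h := fun q : T => - (q.1 *m q.1^T) i j) c1).
    by apply: cvgN; exact: (@cvg_coord _ _ nbp).
  by move=> q [[oq _] _ _]; rewrite oq.
have y0 : nneg_orthant p.2.1.
  move=> i; rewrite -oppr_le0.
  apply: (closure_le (h := fun q : T => - q.2.1 i 0) c1).
    by apply: cvgN; exact: (@cvg_coord _ _ nbp).
  by move=> q [_ q0 _]; rewrite oppr_le0.
exists p.1, p.2.1, p.2.2; split => //.
  split => // x Fx.
  apply: (closure_le (h := fun q : T =>
    sqnorm (diag_mx q.2.1^T *m (q.1 *m x) + q.2.2)) c1); last first.
    by move=> q [[_ /(_ x Fx)]].
  apply: (@cvg_sum _ _ nbp) => i; rewrite diag_affineE.
  under eq_fun do rewrite diag_affineE.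
  apply: (cvg_comp _ (fun a : R => a ^+ 2)); last exact: exprn_continuous.
  apply: cvgD; last exact: (@cvg_coord _ _ nbp).
  apply: cvgM; first exact: (@cvg_coord _ _ nbp).
  apply: (@cvg_coord _ _ nbp); apply: (@cvg_mulmx _ _ nbp) => //.
  exact: cvg_cst.
move=> e e0.
apply: (closure_le (h := fun q : T => g (q.2.1 + const_mx e)) (clC e e0)).
  apply: (cvg_comp _ g); last exact/(es_cont hg)/nneg_add_const_pos.
  by apply: cvgD => //; exact: cvg_cst.
by move=> q [].
Qed.

(** Any positive z above y lies below the bound m too: compare z + e with y + e
    and let e tend to 0. *)
Lemma limit_value_le (m : R) y z :
  pos_orthant z -> (forall i, y i 0 <= z i 0) -> nneg_orthant y ->
  (forall e, 0 < e -> g (y + const_mx e) <= m + e) -> g z <= m.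
Proof.
move=> z0 yz y0 gy; pose h (e : R) := g (z + const_mx e) - e.
have zc0 : z + const_mx 0 = z by apply/matrixP => i j; rewrite !mxE addr0.
have -> : g z = h 0 by rewrite /h zc0 subr0.
apply: (@closure_le _ _ [set e : R | 0 < e]).
- move=> N /nbhs_ballP[r /= r0 rN]; exists (r / 2); split => /=.
    by rewrite divr_gt0.
  apply: rN; rewrite /ball /= sub0r normrN gtr0_norm ?divr_gt0 //.
  by rewrite ltr_pdivrMr // mulr_natr mulr2n ltrDl.
- apply: cvgB; last exact: cvg_id.
  apply: (cvg_comp _ g); last by apply: (es_cont hg); rewrite zc0.
  apply: cvgD; first exact: cvg_cst.
  apply: (@cvg_mx _ _ (nbhs (0 : R))) => i j; rewrite mxE.
  by under eq_fun do rewrite mxE; exact: cvg_id.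
- move=> e /= e0; rewrite lerBlDr; apply: le_trans (gy e e0).
  apply: (es_anti_le hg); first exact: nneg_add_const_pos.
  by move=> i; rewrite !mxE lerD2r.
Qed.

End MinimizingSequences.
(** * A degenerate limit is not optimal *)

Section Nondegenerate.
Variables (R : realType) (d : nat) (F : set 'cV[R]_d) (g : 'cV[R]_d -> R).
Hypothesis hg : eigenvalue_size g.
Implicit Types (x y z t s w : 'cV[R]_d) (P Q A U V : 'M[R]_d).

(** Let e be the indicator of the coordinates where y vanishes. Along y + a *: e
    the convex function g decreases at least linearly in a near 0, whereas the
    quadratic forms change only by O(a ^ 2) on the bounded set F. The loss in the
    constraint is compensated by moving a fraction s = O(a ^ 2) towards the
    positive vector y / 2 + e, where g has the finite value K: this shrinks the
    other coordinates by the factor 1 - s / 2 and costs O(a ^ 2) in g. So for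
    small a the constraint holds and g is below m. In the flat coordinates the
    translation only spoils the constraint, and it is replaced by 0. *)
Lemma flat_directions_improve (m M : R) U y t :
  0 <= m -> 1 <= M -> (forall x, F x -> sqnorm x <= M) ->
  feasible F U y t -> nneg_orthant y -> ~ pos_orthant y ->
  (forall e, 0 < e -> g (y + const_mx e) <= m + e) ->
  exists y' t', [/\ feasible F U y' t', pos_orthant y' & g y' < m].
Proof.
move=> m0 M1 FM [oU FU] y0 ypos gy.
pose e : 'cV[R]_d := \col_i (y i 0 == 0)%:R.
have e0 i : 0 <= e i 0 by rewrite mxE ler0n.
have [j yj] : exists j, y j 0 = 0.
  move: ypos => /existsNP[j /negP]; rewrite -leNgt => yj.
  by exists j; apply/eqP; rewrite eq_le yj y0.
have ej : e j 0 = 1 by rewrite mxE yj eqxx.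
have comb (a b : R) i : (a *: y + b *: e) i 0 = a * y i 0 + b * e i 0.
  by rewrite !mxE.
have ye_pos (a b : R) : 0 < a -> 0 < b -> pos_orthant (a *: y + b *: e).
  move=> a0 b0 i; rewrite !mxE; case: eqVneq => [->|yi].
    by rewrite mulr0 add0r mulr1.
  by rewrite mulr0 addr0 mulr_gt0 // lt_def yi y0.
have y_le (b : R) i : 0 <= b -> y i 0 <= (1 *: y + b *: e) i 0.
  by move=> b0; rewrite comb mul1r lerDl mulr_ge0.
have le_m (b : R) : 0 < b -> g (1 *: y + b *: e) <= m.
  move=> b0; apply: (limit_value_le hg (y := y)) => //.
    exact: ye_pos.
  by move=> i; apply: y_le; exact: ltW.
pose c := m - g (1 *: y + 1 *: e).
have c0 : 0 < c.
  rewrite subr_gt0; apply: lt_le_trans (le_m 2^-1 _); last by rewrite invr_gt0.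
  have h2 : 0 < (2^-1 : R) < 1 by lra.
  case/andP: h2 => h0 h1.
  apply: (es_anti hg); first exact: ye_pos.
    by move=> i; rewrite !comb; have := e0 i; lra.
  by apply/eqP => /matrixP /(_ j 0); rewrite !comb ej yj; lra.
pose K := g (2^-1 *: y + 1 *: e).
have K0 : 0 <= K by apply: (es_ge0 hg); apply: ye_pos; rewrite ?invr_gt0.
have M0 : 0 < M := lt_le_trans ltr01 M1.
have Kc0 : 0 < K + 2 * c by rewrite ltr_wpDl // mulr_gt0.
(* The step a is about 2 * q. The constraint needs 9 * q ^+ 2 * M <= s / 2,
   which fixes s; then s * K must stay below the gain q * c, which fixes q. *)
have [q q0 qE] : exists2 q, 0 < q & 18 * M * q * (K + 2 * c) = c.
  exists (c / (18 * M * (K + 2 * c))); first by rewrite divr_gt0 ?mulr_gt0.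
  by field; rewrite ?gt_eqF.
have Mq : 18 * M * q <= 2^-1.
  by nra.
have q1 : q < 2^-1 by nra.
pose s := 18 * M * q ^+ 2.
have s0 : 0 < s by rewrite !mulr_gt0 // exprn_gt0.
have sq : s <= q / 2 by rewrite /s; nra.
pose a := q + (1 - q) * q.
pose v := 1 *: y + a *: e.
have a0 : 0 < a by rewrite /a; nra.
(* v averages y + e, where g is m - c, and y + q *: e, where g is at most m. *)
have gv : g v <= m - q * c.
  have -> : v = q *: (1 *: y + 1 *: e) + (1 - q) *: (1 *: y + q *: e).
    by apply/colP => i; rewrite !mxE /a; ring.
  have q01 : 0 < q < 1 by lra.
  apply: le_trans (es_conv_le hg (ye_pos _ _ _ _) (ye_pos _ _ _ _) q01) _ => //.
  have := le_m q q0; rewrite /c; set G1 := g _; set G2 := g _ => h; nra.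
pose b := (1 - s) * a + s.
have b0 : 0 < b by rewrite /b; nra.
have h0 : 0 < 1 - s / 2 by lra.
pose y' := (1 - s / 2) *: y + b *: e.
pose t' : 'cV[R]_d := \col_i (if y i 0 == 0 then 0 else (1 - s / 2) * t i 0).
exists y', t'; split.
- split => // x Fx.
  have Ux : sqnorm (U *m x) <= M by rewrite sqnorm_orthogonal ?FM.
  have bound i : (diag_mx y'^T *m (U *m x) + t') i 0 ^+ 2 <=
      (1 - s / 2) ^+ 2 * (diag_mx y^T *m (U *m x) + t) i 0 ^+ 2
      + b ^+ 2 * (U *m x) i 0 ^+ 2.
    rewrite !diag_affineE; set u := (U *m x) i 0.
    rewrite /y' comb [e i 0]mxE [t' i 0]mxE.
    case: eqVneq => [->|_].
      rewrite mulr0 add0r mulr1 addr0 exprMn lerDr mulr_ge0 ?sqr_ge0 //.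
    rewrite mulr0 addr0 -mulrA -mulrDr exprMn lerDl mulr_ge0 ?sqr_ge0 //.
  apply: le_trans (ler_sum _ (fun i _ => bound i)) _.
  rewrite big_split /= -!mulr_sumr -!/(sqnorm _).
  have := FU x Fx; set N := sqnorm _ => N1.
  have b3 : b <= 3 * q by rewrite /b /a; nra.
  have t1 : (1 - s / 2) ^+ 2 * N <= 1 - s / 2 by nra.
  have t2 : b ^+ 2 * sqnorm (U *m x) <= 9 * q ^+ 2 * M.
    apply: ler_pM => //; first exact: sqr_ge0; first exact: sqnorm_ge0.
    by nra.
  by move: t1 t2; rewrite /s; lra.
- exact: ye_pos.
- have -> : y' = (1 - s) *: v + (1 - (1 - s)) *: (2^-1 *: y + 1 *: e).
    by apply/colP => i; rewrite !mxE /b; field.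
  have s01 : 0 < 1 - s < 1 by lra.
  apply: le_lt_trans (es_conv_le hg _ _ s01) _; [exact: ye_pos|exact: ye_pos|].
  rewrite -/K.
  have : s * (K + 2 * c) = q * c by rewrite /s -[in RHS]qE; ring.
  have h1 : (1 - s) * g v <= (1 - s) * (m - q * c) by rewrite ler_wpM2l //; lra.
  have h2 : 0 < s * c by rewrite mulr_gt0.
  have h3 : 0 <= s * m by rewrite mulr_ge0 // ltW.
  have h4 : q * (s * c) <= s * c by rewrite ler_piMl ?ltW //; lra.
  by lra.
Qed.

End Nondegenerate.

(** * Existence of the minimal ellipsoid *)

Section Existence.
Variables (R : realType) (d : nat) (f : 'cV[R]_d -> R) (F : set 'cV[R]_d).
Hypothesis hf : size_function f.
Hypothesis hconv : strictly_convex_on (@pos_orthant R d) (f \o w_pow (-1)).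
Hypothesis hF : compact F.
Hypothesis Fint : F° !=set0.
Implicit Types (x y z t s w : 'cV[R]_d) (P Q A U V : 'M[R]_d).

Local Notation g := (f \o w_pow (-1)).
Let hg : eigenvalue_size g := size_function_eigenvalue_size hf hconv.

Lemma feasible_ellipsoid U y t : feasible F U y t -> pos_orthant y ->
  exists P s, [/\ P^T = P, posdef P, F `<=` ellipsoid P s &
    ellipsoid_size f (ellipsoid P s) = g y].
Proof.
move=> [oU FU] y0; pose P := U^T *m diag_mx y^T *m U; pose s := U^T *m t.
have oUt := orthogonal_trK oU.
have sP : P^T = P by rewrite /P !trmx_mul tr_diag_mx trmxK mulmxA.
have UP : U *m P = diag_mx y^T *m U by rewrite /P !mulmxA oU mul1mx.
have UPU : U *m P *m U^T = diag_mx y^T by rewrite UP -mulmxA oU mulmx1.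
have pP : posdef P.
  move=> x x0; have Ux0 : U *m x != 0.
    apply: contra x0 => /eqP Ux; apply/eqP.
    by rewrite -[x]mul1mx -oUt -mulmxA Ux mulmx0.
  have [i Uxi] : exists i, (U *m x) i 0 != 0.
    apply/existsP; rewrite -negb_forall; apply: contra Ux0 => /forallP h.
    by apply/eqP/colP => i; rewrite [RHS]mxE; exact/eqP.
  have -> : x^T *m P *m x = (U *m x)^T *m (diag_mx y^T *m (U *m x)).
    by rewrite /P trmx_mul !mulmxA.
  move: (U *m x) Uxi => z zi.
  have -> : (z^T *m (diag_mx y^T *m z)) 0 0 = \sum_k y k 0 * z k 0 ^+ 2.
    rewrite mxE; apply: eq_bigr => k _.
    by rewrite mul_diag_mx !mxE mulrCA expr2.
  rewrite (bigD1 i) //= ltr_pwDl //.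
    by rewrite mulr_gt0 // exprn_even_gt0.
  by apply: sumr_ge0 => k _; rewrite mulr_ge0 ?sqr_ge0 // ltW.
exists P, s; split => //.
  move=> x Fx; apply/ellipsoidE; rewrite -(sqnorm_orthogonal _ oU).
  by rewrite mulmxDr mulmxA UP /s mulmxA oU mul1mx -mulmxA; exact: FU.
have dU : is_diag_mx (U *m P *m U^T) by rewrite UPU diag_mx_is_diag.
rewrite (ellipsoid_size_diagonalized s hf sP pP oU dU).
by congr (g _); apply/colP => i; rewrite mxE UPU !mxE eqxx.
Qed.

(** Here U comes from the spectral theorem contained in [schur]. *)
Lemma ellipsoid_feasible P s : P^T = P -> posdef P -> F `<=` ellipsoid P s ->
  exists U y t, [/\ feasible F U y t, pos_orthant y &
    ellipsoid_size f (ellipsoid P s) = g y].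
Proof.
move=> sP pP FP.
have [U [oU dU sz _ _]] := ellipsoid_size_schur hf hconv s sP pP.
exists U, (conj_diag U P), (U *m s); split => //; last exact: conj_diag_pos.
split => // x Fx; have /ellipsoidE := FP x Fx.
rewrite -(sqnorm_orthogonal _ oU) mulmxDr mulmxA.
suff -> : diag_mx (conj_diag U P)^T *m (U *m x) = U *m P *m x by [].
have -> : diag_mx (conj_diag U P)^T = U *m P *m U^T.
  apply/matrixP => i j; rewrite mxE [_^T _ _]mxE [conj_diag _ _ _ _]mxE.
  have [<-|ij] := eqVneq i j; first by rewrite mulr1n.
  by rewrite mulr0n; move/is_diag_mxP : dU => ->.
by rewrite mulmxA -(mulmxA _ U^T) orthogonal_trK // mulmx1.
Qed.

Lemma compact_sqnorm_bounded : exists2 M : R, 1 <= M &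
  forall x, F x -> sqnorm x <= M.
Proof.
have [B [_ FB]] := compact_bounded hF.
pose b := `|B| + 1.
have b0 : 0 <= b by rewrite addr_ge0.
have Bb : B < b by rewrite (le_lt_trans (ler_norm B)) // ltrDl.
exists (1 + \sum_(i < d) b ^+ 2).
  by rewrite lerDl; apply: sumr_ge0 => i _; exact: sqr_ge0.
move=> x Fx; apply: le_trans (_ : \sum_(i < d) b ^+ 2 <= _).
  2: by rewrite lerDr.
apply: ler_sum => i _.
have xb : `|x i 0| <= b.
  apply: le_trans (FB b Bb x Fx).
  rewrite [leRHS]mx_normrE.
  exact: (le_bigmax _ (fun ij => `|x ij.1 ij.2|) (i, 0)).
by rewrite -[x i 0 ^+ 2]real_normK ?num_real // lerXn2r ?nnegrE.
Qed.

(** The infimum m of g over positive feasible data is approached by data whose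
    limit satisfies the constraint. That limit is positive by
    [flat_directions_improve], since nothing feasible is better than m, so it is
    an ellipsoid of size m. *)
Lemma minimal_ellipsoid_exists : exists E, minimal_ellipsoid f F E.
Proof.
have [M M1 FM] := compact_sqnorm_bounded.
pose S : set R := [set r | exists U y t,
  [/\ feasible F U y t, pos_orthant y & r = g y]].
have S0 : S !=set0.
  pose k := (Num.sqrt M)^-1.
  have k0 : 0 < k by rewrite invr_gt0 sqrtr_gt0 (lt_le_trans ltr01).
  exists (g (const_mx k)), 1%:M, (const_mx k), 0; split => //.
    split=> [|x Fx]; first exact: orthogonal1.
    have -> : diag_mx (const_mx k)^T *m (1%:M *m x) + 0 = k *: x.
      by rewrite trmx_const diag_const_mx mul1mx mul_scalar_mx addr0.
    rewrite sqnormZ exprVn sqr_sqrtr; last exact: le_trans M1.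
    by rewrite mulrC ler_pdivrMr ?mul1r ?FM // (lt_le_trans ltr01).
  by move=> i; rewrite mxE.
have Slb : lbound S 0 by move=> _ [U [y [t [_ y0 ->]]]]; exact: (es_ge0 hg).
have hS : has_inf S by split => //; exists 0.
pose m := inf S.
have m0 : 0 <= m by exact: lb_le_inf.
have m_le U y t : feasible F U y t -> pos_orthant y -> m <= g y.
  by move=> Uyt y0; apply: ge_inf; [exists 0|exists U, y, t].
have [|U [y [t [Uyt y0 gy]]]] := feasible_limit hg Fint (m := m).
  move=> e e0; have [_ [U [y [t [Uyt y0 ->]]]] lt] := inf_adherent e0 hS.
  by exists U, y, t; split => //; exact: ltW.
have ypos : pos_orthant y.
  apply: contrapT => ynpos.
  have [y' [t' [Uyt' y'0]]] :=
    flat_directions_improve hg m0 M1 FM Uyt y0 ynpos gy.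
  by rewrite ltNge (m_le _ _ _ Uyt').
have gym : g y <= m.
  exact: (limit_value_le hg ypos (fun i => lexx (y i 0)) y0 gy).
have [P [s [sP pP FP sz]]] := feasible_ellipsoid Uyt ypos.
exists (ellipsoid P s); split => //.
  by exists P, s; split => //; exact/symmetricmxP.
move=> _ [Q [r [/symmetricmxP sQ pQ ->]]] FQ.
have [V [z [w [Vzw z0 ->]]]] := ellipsoid_feasible sQ pQ FQ.
by rewrite sz (le_trans gym) // (m_le _ _ _ Vzw).
Qed.

End Existence.

Theorem theorem9 (R : realType) (d : nat) (f : 'cV[R]_d -> R)
    (F : set 'cV[R]_d)
    (hf : size_function f)
    (hconv : strictly_convex_on (@pos_orthant R d) (f \o w_pow (-1)))
    (hF : convex_body F) :
  exists! E : set 'cV[R]_d, minimal_ellipsoid f F E.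
Proof.
have [cF _ iF] := hF.
have [E minE] := minimal_ellipsoid_exists hf hconv cF iF.
by exists E; split => // E'; exact: (minimal_ellipsoid_unique hf hconv).
Qed.
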